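(* Let $V$ be an $n$-dimensional real vector space with frame (ordered basis) $e=(e_1,\dots,e_n)$, and let $\Omega$ be an $n\times n$ matrix with entries in $\wedge^2 V$. Let $\{w_k : 1\le k\le \binom{n}{2}\}=\{e_i\wedge e_j : 1\le i<j\le n\}$ be the standard basis of $\wedge^2 V$ associated with $e$, and let $S_1,\dots,S_{\binom{n}{2}}$ be the $n\times n$ real matrices determined by $$\Omega=\sum_{k=1}^{\binom{n}{2}} w_k S_k .$$ Then $\Omega$ is skewable if and only if the set of matrices $\{S_1,\dots,S_{\binom{n}{2}}\}$ is simultaneously skewable.
   Context: $\wedge^2 V=V\wedge V$ denotes the second exterior power of the real vector space $V$. For $w\in\wedge^2 V$ and a real $n\times n$ matrix $S$, $wS$ is the matrix with entries in $\wedge^2V$ whose $(i,j)$ entry is $S(i,j)\,w$. Products of real matrices with matrices over $\wedge^2 V$ are defined by the usual matrix multiplication formula, using scalar multiplication on $\wedge^2V$. An $n\times n$ matrix $\Omega$ with entries in $\wedge^2 V$ is skewable if there is a nonsingular $n\times n$ real matrix $U$ such that $(U^{-1}\Omega U)^T=-U^{-1}\Omega U$, i.e. $U^{-1}\Omega U$ is skew-symmetric. A set $\{S_1,\dots,S_m\}$ of $n\times n$ real matrices is simultaneously skewable if there exists a nonsingular real $n\times n$ matrix $U$ such that $U^{-1}S_kU$ is skew-symmetric for every $1\le k\le m$. *)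

(* Defs.v *)
From HB Require Import structures.
From mathcomp Require Import all_boot all_order all_algebra.
From mathcomp Require Import reals ring.

Set Implicit Arguments.
Unset Strict Implicit.
Unset Printing Implicit Defensive.

Import Order.TTheory GRing.Theory Num.Theory.

Local Open Scope ring_scope.

Definition alternating (R : nzRingType) (V W : lmodType R)
    (f : {bilinear V -> V -> W}) : Prop :=
  forall x : V, f x x = 0.

(* The pair (W, wedge) is the second exterior power of V, given by its
   universal property: every alternating bilinear map out of V x V factors
   uniquely through wedge. *)
Definition is_exterior_square (R : nzRingType) (V W : lmodType R)
    (wedge : {bilinear V -> V -> W}) : Prop :=
  alternating wedge /\
  forall (U : lmodType R) (f : {bilinear V -> V -> U}), alternating f ->
    exists g : {linear W -> U},
      (forall x y : V, g (wedge x y) = f x y) /\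
      (forall g' : {linear W -> U},
         (forall x y : V, g' (wedge x y) = f x y) -> g' =1 g).

(* {w_k} = {e_i /\ e_j : i < j}. Since the index k ranges over 'C(n, 2) values,
   this makes w an enumeration of the standard basis, in any order. *)
Definition standard_wedge_basis (R : nzRingType) (V W : lmodType R)
    (wedge : {bilinear V -> V -> W}) (n : nat) (e : n.-tuple V)
    (w : 'I_'C(n, 2) -> W) : Prop :=
  forall x : W, (exists k, x = w k) <->
    (exists i j : 'I_n, (i < j)%N /\ x = wedge (tnth e i) (tnth e j)).

Section VectorMatrices.
Variables (R : nzRingType) (W : lmodType R).

Definition vscale_mx (m n : nat) (w : W) (S : 'M[R]_(m, n)) : 'M[W]_(m, n) :=
  \matrix_(i, j) (S i j *: w).

Definition lmul_vmx (m n p : nat) (A : 'M[R]_(m, n)) (M : 'M[W]_(n, p)) :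
    'M[W]_(m, p) :=
  \matrix_(i, j) \sum_k A i k *: M k j.

Definition rmul_vmx (m n p : nat) (M : 'M[W]_(m, n)) (A : 'M[R]_(n, p)) :
    'M[W]_(m, p) :=
  \matrix_(i, j) \sum_k A k j *: M i k.

End VectorMatrices.

Definition skew_symmetric (W : zmodType) (n : nat) (M : 'M[W]_n) : Prop :=
  M^T = - M.

Definition skewable (R : comUnitRingType) (W : lmodType R) (n : nat)
    (Omega : 'M[W]_n) : Prop :=
  exists2 U : 'M[R]_n, U \in unitmx &
    skew_symmetric (rmul_vmx (lmul_vmx (invmx U) Omega) U).

Definition simultaneously_skewable (R : comUnitRingType) (n m : nat)
    (S : 'I_m -> 'M[R]_n) : Prop :=
  exists2 U : 'M[R]_n, U \in unitmx &
    forall k : 'I_m, skew_symmetric (invmx U *m S k *m U).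

(* A model of the exterior square of a finite-dimensional space, showing that
   is_exterior_square is satisfiable: coordinates indexed by pairs i < j. *)
Section Existence.
Variables (R : fieldType) (V : vectType R).

Local Notation d := (\dim {:V}).
Local Notation b := (vbasis {:V}).
Local Notation pairs := {p : 'I_d * 'I_d | (p.1 < p.2)%N}.
Local Notation W := {ffun pairs -> R^o}.

Definition coord_wedge (x y : V) : W :=
  [ffun p : pairs => (coord b (val p).1 x * coord b (val p).2 y
                      - coord b (val p).2 x * coord b (val p).1 y : R^o)].

Fact coord_wedge_bilinear : bilinear_for *:%R *:%R coord_wedge.
Proof.
by split=> [y|x] a u v; apply/ffunP=> p;
  rewrite !ffunE !linearP /= /GRing.scale /=; ring.
Qed.

HB.instance Definition _ :=
  bilinear_isBilinear.Build R V V W _ _ coord_wedge coord_wedge_bilinear.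

Lemma alternating_anti (U : lmodType R) (f : {bilinear V -> V -> U}) (x y : V) :
  alternating f -> f y x = - f x y.
Proof.
move=> f_alt; apply/eqP; rewrite -addr_eq0 addrC; apply/eqP.
by have := f_alt (x + y); rewrite linearDl !linearDr !f_alt add0r addr0.
Qed.

Definition wedge_lift (U : lmodType R) (f : {bilinear V -> V -> U}) (t : W) : U :=
  \sum_p (t p : R) *: f b`_(val p).1 b`_(val p).2.

Fact wedge_lift_linear (U : lmodType R) (f : {bilinear V -> V -> U}) :
  linear (wedge_lift f).
Proof.
move=> a s t; rewrite /wedge_lift scaler_sumr -big_split /=.
apply: eq_bigr => p _.
by rewrite !ffunE scalerDl scalerA.
Qed.

Lemma sum_pairs (U : zmodType) (F : 'I_d -> 'I_d -> U) :
    (forall i, F i i = 0) ->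
  \sum_i \sum_j F i j =
  \sum_(p : pairs) (F (val p).1 (val p).2 + F (val p).2 (val p).1).
Proof.
move=> F0; rewrite pair_big /=.
have sum_lt (G : 'I_d * 'I_d -> U) :
    \sum_(p : pairs) G (val p) = \sum_(p : 'I_d * 'I_d | (p.1 < p.2)%N) G p.
  by rewrite (big_sub (fun p : 'I_d * 'I_d => (p.1 < p.2)%N)).
rewrite (sum_lt (fun p => F p.1 p.2 + F p.2 p.1)) big_split /=.
rewrite (bigID (fun p : 'I_d * 'I_d => (p.1 < p.2)%N)) /=; congr (_ + _).
rewrite (bigID (fun p : 'I_d * 'I_d => (p.2 < p.1)%N)) /=.
rewrite [X in _ + X]big1 ?addr0 => [|[i j] /= /andP[ij ji]]; last first.
  by have -> : i = j
    by apply/val_inj/eqP; rewrite eqn_leq (leqNgt j) (leqNgt i) ij ji.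
pose sw (p : 'I_d * 'I_d) := (p.2, p.1).
have swK : involutive sw by case.
rewrite (reindex_inj (inv_inj swK)) /=.
by apply: eq_bigl => -[i j] /=; rewrite -leqNgt andb_idl // => /ltnW.
Qed.

Lemma wedge_lift_wedge (U : lmodType R) (f : {bilinear V -> V -> U}) (x y : V) :
  alternating f -> wedge_lift f (coord_wedge x y) = f x y.
Proof.
move=> f_alt.
rewrite {2}(coord_vbasis (memvf x)) {2}(coord_vbasis (memvf y)).
rewrite linear_sumlz.
under eq_bigr => i _ do rewrite linear_sumr.
under eq_bigr => i _ do under eq_bigr => j _ do
  rewrite linearZl_LR linearZr_LR scalerA.
rewrite sum_pairs => [|i]; last by rewrite f_alt scaler0.
apply: eq_bigr => p _; rewrite ffunE scalerBl.
by rewrite (alternating_anti b`_(val p).1 b`_(val p).2 f_alt) scalerN.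
Qed.

Lemma coord_wedge_vbasis (p q : pairs) :
  coord_wedge b`_(val p).1 b`_(val p).2 q = (q == p)%:R.
Proof.
have b_free : free b := basis_free (vbasisP _).
rewrite ffunE !coord_free //.
have -> : (q == p) = ((val p).1 == (val q).1) && ((val p).2 == (val q).2).
  by rewrite eq_sym -val_eqE; case: (val p) (val q) => [? ?] [].
have [/andP[/eqP pq1 /eqP pq2]|/negPf pq] :=
    boolP (((val p).1 == (val q).2) && ((val p).2 == (val q).1)).
  have := valP p; rewrite /= pq1 pq2 ltnNge => /negP[].
  by apply: ltnW; exact: (valP q).
by rewrite -!natrM !mulnb pq subr0.
Qed.

Lemma wedge_span (t : W) :
  t = \sum_p (t p : R) *: coord_wedge b`_(val p).1 b`_(val p).2.
Proof.
apply/ffunP=> q; rewrite sum_ffunE (bigD1 q) //= big1 => [|p pq].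
  by rewrite addr0 ffunE coord_wedge_vbasis eqxx /GRing.scale /= mulr1.
by rewrite ffunE coord_wedge_vbasis eq_sym (negPf pq) scaler0.
Qed.

Lemma exterior_square_exists :
  exists (E : lmodType R) (wedge : {bilinear V -> V -> E}),
    is_exterior_square wedge.
Proof.
pose cw : {bilinear V -> V -> W} := coord_wedge.
exists W, cw; split=> [x|U f f_alt].
  by apply/ffunP=> p; rewrite [LHS]ffunE mulrC subrr ffunE.
pose L := GRing.isLinear.Build R W U _ (wedge_lift f) (wedge_lift_linear f).
pose g : {linear W -> U} := HB.pack (wedge_lift f) L.
exists g; split=> [x y|g' g'E t]; first exact: wedge_lift_wedge.
rewrite {1}(wedge_span t) linear_sum /=; apply: eq_bigr => p _.
by rewrite linearZ /= (g'E b`_(val p).1).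
Qed.

End Existence.

(* Main.v *)
(* The 2x2 minors of coordinates in the frame e are alternating forms, so they
   factor through linear forms on the exterior square, which separate the
   e_i /\ e_j with i < j. As w takes all these 'C(n, 2) distinct values on
   'C(n, 2) indices, it is injective, so these forms are dual to (w_k).
   Conjugation by U commutes with the expansion along the w_k, and applying the
   dual forms entrywise reads off the coefficients, so the same U serves on both
   sides. *)
Require Import Defs.
From HB Require Import structures.
From mathcomp Require Import all_boot all_order all_algebra.
From mathcomp Require Import reals ring.

Set Implicit Arguments.
Unset Strict Implicit.
Unset Printing Implicit Defensive.

Local Open Scope ring_scope.

Import GRing.Theory.

Section CoordinateMinors.
Variables (R : fieldType) (V : vectType R) (n : nat) (e : n.-tuple V).

(** The codomain is [R^o], the field as a module over itself, so that the universal property of the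
    exterior square applies to this form. *)
Definition coord_minor (i j : 'I_n) (x y : V) : R^o :=
  coord e i x * coord e j y - coord e j x * coord e i y.

Fact coord_minor_bilinear (i j : 'I_n) :
  bilinear_for *:%R *:%R (coord_minor i j).
Proof.
by split=> [y|x] a u v; rewrite /coord_minor !linearP /= /GRing.scale /=; ring.
Qed.

HB.instance Definition _ (i j : 'I_n) :=
  bilinear_isBilinear.Build R V V R^o _ _ (coord_minor i j)
    (coord_minor_bilinear i j).

Lemma coord_minor_free (i j k l : 'I_n) : free e -> (i < j)%N -> (k < l)%N ->
  coord_minor i j (tnth e k) (tnth e l) = ((i, j) == (k, l))%:R.
Proof.
move=> e_free ij kl; rewrite /coord_minor !(tnth_nth 0) !coord_free //.
(* The subtracted product survives only if [k = j] and [l = i], which the two orderings exclude. *)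
have kl_neq : (k == j :> nat) && (l == i :> nat) = false.
  by apply/negP => /andP[/eqP kj /eqP li]; move: kl; rewrite kj li ltnNge ltnW.
by rewrite -!natrM !mulnb kl_neq subr0 xpair_eqE (eq_sym i) (eq_sym j).
Qed.

End CoordinateMinors.

(** A larger index [j] leaves [j] choices for the smaller one, and the sum of all [j < n] is
    ['C(n, 2)]. *)
Lemma card_ltn_pairs (n : nat) :
  #|{: {p : 'I_n * 'I_n | (p.1 < p.2)%N}}| = 'C(n, 2).
Proof.
rewrite card_sig -sum1_card.
rewrite (eq_bigl (fun p : 'I_n * 'I_n => true && (p.1 < p.2)%N)) //.
rewrite -(pair_big_dep xpredT (fun i j : 'I_n => (i < j)%N) (fun _ _ => 1%N)) /=.
rewrite (exchange_big_dep xpredT) //= -bin2_sum big_mkord.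
apply: eq_bigr => j _.
have <- := big_ord_widen (op := addn) (idx := 0%N) n (fun=> 1%N) (ltnW (ltn_ord j)).
by rewrite sum1_card card_ord.
Qed.

Lemma standard_wedge_basis_dual (R : fieldType) (V : vectType R) (n : nat)
    (e : n.-tuple V) (W : lmodType R) (wedge : {bilinear V -> V -> W})
    (w : 'I_'C(n, 2) -> W) :
  free e -> is_exterior_square wedge -> standard_wedge_basis wedge e w ->
  exists phi : 'I_'C(n, 2) -> {linear W -> R^o},
    forall k l, phi k (w l) = (k == l)%:R.
Proof.
move=> e_free [_ lift] w_basis.
pose pairs := {p : 'I_n * 'I_n | (p.1 < p.2)%N}.
have /fin_all_exists[psi psiE] (p : pairs) : exists g : {linear W -> R^o},
    forall x y, g (wedge x y) = coord_minor e (val p).1 (val p).2 x y.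
  have alt : alternating (coord_minor e (val p).1 (val p).2).
    by move=> x; rewrite /= /coord_minor mulrC subrr.
  by have [g [gE _]] := lift _ _ alt; exists g.
pose ew (p : pairs) := wedge (tnth e (val p).1) (tnth e (val p).2).
have psi_ew p q : psi p (ew q) = (p == q)%:R.
  by rewrite psiE coord_minor_free ?(valP p) ?(valP q) // -val_eqE.
have /fin_all_exists[f fE] k : exists p, w k = ew p.
  have [i [j [ij wk]]] := (w_basis (w k)).1 (ex_intro _ k erefl).
  by exists (exist _ (i, j) ij).
have /fin_all_exists[g gE] p : exists k, ew p = w k.
  by apply/w_basis; exists (val p).1, (val p).2; split; first exact: (valP p).
(* Here [ew p = w (g p) = ew (f (g p))], and [psi p] is 1 on [ew p] but 0 on every other [ew q]. *)
have gK : cancel g f.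
  move=> p; have := psi_ew p p; rewrite gE fE psi_ew eqxx.
  by case: eqP => // _ /eqP; rewrite eq_sym oner_eq0.
(* Being injective between finite types of equal size, [g] is bijective, and [f] is its inverse. *)
have f_inj : injective f.
  apply/bij_inj/(bij_can_bij _ gK)/(inj_card_bij (can_inj gK)).
  by rewrite card_ltn_pairs card_ord.
by exists (psi \o f) => k l /=; rewrite fE psi_ew (inj_eq f_inj).
Qed.

Section VectorMatrixExpansion.
Variables (R : comNzRingType) (W : lmodType R).

Lemma mulmx_sum_vscale (m n p q r : nat) (A : 'M[R]_(p, m)) (B : 'M[R]_(n, q))
    (w : 'I_r -> W) (S : 'I_r -> 'M[R]_(m, n)) :
  rmul_vmx (lmul_vmx A (\sum_k vscale_mx (w k) (S k))) B =
  \sum_k vscale_mx (w k) (A *m S k *m B).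
Proof.
apply/matrixP=> i j; rewrite mxE summxE.
under [RHS]eq_bigr => k _ do rewrite !mxE scaler_suml.
rewrite [RHS]exchange_big /=; apply: eq_bigr => b _.
rewrite mxE scaler_sumr.
under [RHS]eq_bigr => k _ do rewrite mxE mulr_suml scaler_suml.
rewrite [RHS]exchange_big /=; apply: eq_bigr => a _.
rewrite summxE !scaler_sumr; apply: eq_bigr => k _.
(* Entries of [B] scale from the left in [rmul_vmx] but are right factors in the matrix product;
   commutativity of [R] reconciles the two. *)
by rewrite mxE !scalerA -[in LHS]mulrA mulrC.
Qed.

Lemma skew_symmetric_sum_vscale (n r : nat) (w : 'I_r -> W)
    (phi : 'I_r -> {linear W -> R^o}) (T : 'I_r -> 'M[R]_n) :
  (forall k l, phi k (w l) = (k == l)%:R) ->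
  skew_symmetric (\sum_k vscale_mx (w k) (T k)) <->
  forall k, skew_symmetric (T k).
Proof.
move=> phi_w; split=> [skew k|skew].
  (* Duality kills every term but the [k]-th, so the linear form [phi k] carries skewness of the sum
     over to [T k]. *)
  have phiE i j : phi k ((\sum_l vscale_mx (w l) (T l)) i j) = T k i j.
    rewrite summxE linear_sum (bigD1 k) //= big1 => [|l lk].
      by rewrite addr0 mxE linearZ phi_w eqxx; apply: mulr1.
    by rewrite mxE linearZ phi_w eq_sym (negPf lk); apply: mulr0.
  apply/matrixP=> i j; have /matrixP/(_ i j) := skew; rewrite !mxE.
  by rewrite -[in X in _ -> X]phiE => ->; rewrite linearN phiE.
apply/matrixP=> i j; rewrite !mxE !summxE -sumrN; apply: eq_bigr => k _.
by have /matrixP/(_ i j) := skew k; rewrite !mxE => ->; rewrite scaleNr.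
Qed.

End VectorMatrixExpansion.

Theorem theorem2p6 (R : realType) (n : nat) (V : vectType R)
    (dimV : \dim {:V} = n) (e : n.-tuple V) (e_basis : basis_of {:V} e)
    (W : lmodType R) (wedge : {bilinear V -> V -> W})
    (W_ext : is_exterior_square wedge)
    (w : 'I_'C(n, 2) -> W) (w_basis : standard_wedge_basis wedge e w)
    (Omega : 'M[W]_n) (S : 'I_'C(n, 2) -> 'M[R]_n)
    (Omega_eq : Omega = \sum_k vscale_mx (w k) (S k)) :
  skewable Omega <-> simultaneously_skewable S.
Proof.
have [phi phi_w] := standard_wedge_basis_dual (basis_free e_basis) W_ext w_basis.
(* Stated for each fixed [U], so that both existentials share their witness. *)
have skewE (U : 'M[R]_n) :
    skew_symmetric (rmul_vmx (lmul_vmx (invmx U) Omega) U) <->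
    forall k, skew_symmetric (invmx U *m S k *m U).
  by rewrite Omega_eq mulmx_sum_vscale; apply: skew_symmetric_sum_vscale phi_w.
by split=> -[U U_unit /skewE skewU]; exists U.
Qed.
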